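(* Let $A\in\mathbb{R}^{m\times n}$ be an integer (or rational) matrix with $\operatorname{rank}(A)=m$ and let $L$ be the bit size of $A$. The time complexity of the dual algorithm (the Main Algorithm for the Dual Problem, which calls the Basic Procedure for the Dual Problem, both defined in the context) on input $A$ is $O(n^4mL)$.
   Context: Time is counted in arithmetic operations; the step-size $c\in(0,2)$ is a fixed constant. Vector inequalities are coordinatewise, $\mathbf 1$ is the all-ones vector, $e_k$ the $k$th unit vector, $x^+=\max\{0,x\}$ coordinatewise. $(\cdot)^\dagger$ is the Moore-Penrose pseudoinverse. The primal problem is: find $x$ with $Ax=0$, $x\ge0$, $x\ne0$. The dual problem is: find $u\in\mathbb{R}^m$ with $A^Tu>0$; normalized: find $u\in\mathbb{R}^m$ such that $x=A^Tu>0$, $x\in(0,1]^n$. For a matrix $A$, $Q_A=A^T(AA^T)^\dagger A$ and $P_A=I-Q_A$ (orthogonal projections onto the row space and null space). For a vector $y$ put $z=P_Ay$ and, for each $j$ with $z_j\neq0$, $\mathrm{bound}'_j(y)=\mathbf 1^T\big[\frac{z}{-z_j}\big]^+$. Basic Procedure for the Dual Problem. Input: $P_A$ ($n\times n$). Set $\mathrm{threshold}=\frac{1}{2n^{3/2}}$, $y=\mathbf 1/n$, $z=P_Ay$, $v=y-z=Q_Ay$. Repeat the following iteration: (1) if $v>0$, return with case $=2$ (dual feasible); (2) else if $z\ge0$, return with case $=1$ (primal feasible); (3) else let $K=\{k:z_k\le0\}$, $p_K=P_A\sum_{k\in K}e_k$, $\alpha=\langle\frac{p_K}{\|p_K\|_2},z\rangle$.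 If $\alpha\le-\mathrm{threshold}$, replace $y$ by $y-c\frac{\alpha}{\|p_K\|_2}\sum_{k\in K}e_k$, $z$ by $z-c\frac{\alpha}{\|p_K\|_2}p_K$, and $v$ by $y-z$. Otherwise return with case $=0$ and a nonempty set $J\subseteq\{j:\mathrm{bound}'_j(y)\le\frac12\}$. Main Algorithm for the Dual Problem. Start with $d=\mathbf 1\in\mathbb{R}^n$, case $=0$. While case $=0$: compute $P_A=I-A^T(AA^T)^\dagger A$; run the Basic Procedure on $P_A$ to get $(y,z,J,\text{case})$; if case $=0$, set $d_J=2d_J$, multiply the columns of $A$ indexed by $J$ by $2$, set $H=\{i:d_i\ge2^L\}$, $d_H=0$, and replace the columns of $A$ indexed by $H$ by zero. When the loop ends with case $=1$, set $D=\mathrm{diag}(d)$ and output $x=Dz$.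
   Formalization: Halting is asserted only if the dual is feasible; otherwise the algorithm halts within the bound or reaches a state repeating forever (e.g. A=[0 3 4]). J is a function of P_A, y, z; P_A is stored as an orthogonal row-space basis, so a product costs O(mn). *)

(* Defs.v *)
From mathcomp Require Import all_boot all_order all_algebra.
From mathcomp Require classical_sets.
From mathcomp Require Import reals.

Set Implicit Arguments.
Unset Strict Implicit.
Unset Printing Implicit Defensive.

Import Order.TTheory GRing.Theory Num.Theory.
Local Open Scope ring_scope.

Definition is_pinv (R : realType) (m n : nat) (G : 'M[R]_(m, n))
    (X : 'M[R]_(n, m)) : Prop :=
  [/\ G *m X *m G = G, X *m G *m X = X,
      (G *m X)^T = G *m X & (X *m G)^T = X *m G].

Definition pinv (R : realType) (m n : nat) (G : 'M[R]_(m, n)) : 'M[R]_(n, m) :=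
  classical_sets.xget 0 (is_pinv G).

Lemma mulmx_tr_eq0 (R : realType) m n (M : 'M[R]_(m, n)) :
  M *m M^T = 0 -> M = 0.
Proof.
move=> M0; apply/matrixP => i j; rewrite mxE.
have /eqP := congr1 (fun X : 'M_m => X i i) M0.
rewrite !mxE psumr_eq0 => [|k _]; last by rewrite mxE -expr2 sqr_ge0.
by move/allP/(_ j (mem_index_enum j)); rewrite mxE mulf_eq0 orbb => /eqP.
Qed.

Lemma pinvP (R : realType) m n (G : 'M[R]_(m, n)) : is_pinv G (pinv G).
Proof.
rewrite /pinv; case: classical_sets.xgetP => [X _ //|] /(_ _) noX; exfalso.
have gram_unit p q (F : 'M[R]_(p, q)) : row_free F -> F *m F^T \in unitmx.
  move=> freeF; rewrite -row_free_unit -kermx_eq0.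
  have kF : kermx (F *m F^T) *m F = 0.
    apply: mulmx_tr_eq0; rewrite trmx_mul mulmxA -(mulmxA _ F).
    by rewrite mulmx_ker mul0mx.
  by apply/eqP/(row_free_inj freeF); rewrite kF mul0mx.
have [r [C [F [GE fF fC]]]] : exists r (C : 'M[R]_(m, r)) (F : 'M_(r, n)),
    [/\ G = C *m F, row_free F & row_free C^T].
  exists (\rank G), (col_base G), (row_base G).
  rewrite mulmx_base row_base_free /row_free mxrank_tr.
  by split=> //; exact: col_base_full.
have uF : F *m F^T \in unitmx by exact: gram_unit.
have uC : C^T *m C \in unitmx by rewrite -{2}[C]trmxK; exact: gram_unit.
pose X := F^T *m invmx (F *m F^T) *m (invmx (C^T *m C) *m C^T).
have GX : G *m X = C *m invmx (C^T *m C) *m C^T.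
  by rewrite GE /X !mulmxA -(mulmxA C F) mulmxK.
have XG : X *m G = F^T *m invmx (F *m F^T) *m F.
  by rewrite GE /X !mulmxA -(mulmxA _ C^T) mulmxKV.
apply: (noX X); split.
- by rewrite GX {1}GE !mulmxA -(mulmxA _ C^T) mulmxKV // -GE.
- by rewrite XG /X !mulmxA -(mulmxA _ F) mulmxKV.
- by rewrite GX !trmx_mul trmxK trmx_inv trmx_mul trmxK !mulmxA.
- by rewrite XG !trmx_mul trmxK trmx_inv trmx_mul trmxK !mulmxA.
Qed.

Definition Qproj (R : realType) (m n : nat) (A : 'M[R]_(m, n)) : 'M[R]_n :=
  A^T *m pinv (A *m A^T) *m A.

Definition Pproj (R : realType) (m n : nat) (A : 'M[R]_(m, n)) : 'M[R]_n :=
  1%:M - Qproj A.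

Lemma mulmx_Pproj (R : realType) m n (A : 'M[R]_(m, n)) : A *m Pproj A = 0.
Proof.
have [GXG _ sGX _] := pinvP (A *m A^T).
set X := pinv _ in GXG sGX; set G := A *m A^T in GXG sGX.
have E : A *m Pproj A = (1%:M - G *m X) *m A.
  by rewrite /Pproj /Qproj mulmxBr mulmxBl mulmx1 mul1mx !mulmxA.
rewrite E; apply: mulmx_tr_eq0.
rewrite trmx_mul mulmxA -(mulmxA _ A) -/G [X in X *m _]mulmxBl.
by rewrite mul1mx GXG subrr mul0mx.
Qed.

(* sign and binary digits *)
Definition int_bits (a : int) : nat := (up_log 2 (absz a).+1).+1.

Definition rat_bits (q : rat) : nat :=
  if q \is a Num.int then int_bits (numq q)
  else (int_bits (numq q) + up_log 2 (absz (denq q)).+1)%N.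

Definition bit_size (m n : nat) (A : 'M[rat]_(m, n)) : nat :=
  (\sum_(i < m) \sum_(j < n) rat_bits (A i j))%N.

(* A value together with the number of arithmetic operations spent on it.
   Field operations, square roots, maxima and comparisons of real numbers cost
   one; data movement and bookkeeping on index sets are free.  In the code
   below, real numbers are combined only through these primitives. *)
Record timed (T : Type) := Timed { value : T; cost : nat }.

Definition ret (T : Type) (x : T) : timed T := Timed x 0.
Definition bind (T U : Type) (x : timed T) (f : T -> timed U) : timed U :=
  Timed (value (f (value x))) (cost x + cost (f (value x)))%N.

Notation "'let*' x := e 'in' f" := (bind e (fun x => f))
  (at level 200, x name, e at level 200, f at level 200).

Section Primitives.
Variable R : realType.
Implicit Types x y : R.

Definition fopp x := Timed (- x) 1.
Definition fadd x y := Timed (x + y) 1.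
Definition fsub x y := Timed (x - y) 1.
Definition fmul x y := Timed (x * y) 1.
Definition fdiv x y := Timed (x / y) 1.
Definition fsqrt x := Timed (Num.sqrt x) 1.
Definition fmax x y := Timed (Num.max x y) 1.
Definition fle x y := Timed (x <= y) 1.
Definition flt x y := Timed (x < y) 1.
Definition fis0 x := Timed (x == 0) 1.

Definition tsum n (f : 'I_n -> timed R) : timed R :=
  Timed (\sum_i value (f i)) (\sum_i (cost (f i)).+1)%N.
Definition tvec n (f : 'I_n -> timed R) : timed 'cV[R]_n :=
  Timed (\col_i value (f i)) (\sum_i cost (f i))%N.
Definition tmat m n (f : 'I_m -> 'I_n -> timed R) : timed 'M[R]_(m, n) :=
  Timed (\matrix_(i, j) value (f i j)) (\sum_i \sum_j cost (f i j))%N.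
Definition tset n (f : 'I_n -> timed bool) : timed {set 'I_n} :=
  Timed [set i | value (f i)] (\sum_i cost (f i))%N.

Definition fpow x n : timed R := iter n (fun t => let* p := t in fmul x p) (ret 1).

Definition tdot n (x y : 'cV[R]_n) : timed R :=
  tsum (fun i => fmul (x i 0) (y i 0)).

Definition tnorm n (x : 'cV[R]_n) : timed R := let* s := tdot x x in fsqrt s.

Definition tsubscale n (y : 'cV[R]_n) (a : R) (x : 'cV[R]_n) : timed 'cV[R]_n :=
  tvec (fun i => let* b := fmul a (x i 0) in fsub (y i 0) b).

End Primitives.

(* P_A is stored as an orthogonal basis ws of the row space of A, obtained by
   Gram-Schmidt from the rows of A, and P_A x is computed by removing from x
   its components along ws.  A product with P_A thus takes O(mn) operations,
   while the n x n matrix would need O(n^2); see [row_basisP]. *)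
Section Projection.
Variable R : realType.

Fixpoint tproj n (ws : seq 'cV[R]_n) (x : 'cV[R]_n) : timed 'cV[R]_n :=
  if ws is w :: ws' then
    let* p := tdot w x in
    let* q := tdot w w in
    let* a := fdiv p q in
    let* x' := tsubscale x a w in
    tproj ws' x'
  else ret x.

Fixpoint gram_schmidt n (ws rs : seq 'cV[R]_n) : timed (seq 'cV[R]_n) :=
  if rs is r :: rs' then
    let* w := tproj ws r in
    let* S := tset (fun i => let* b := fis0 (w i 0) in ret (~~ b)) in
    gram_schmidt (if S == set0 then ws else w :: ws) rs'
  else ret ws.

Definition row_basis m n (A : 'M[R]_(m, n)) : timed (seq 'cV[R]_n) :=
  gram_schmidt [::] [seq (row i A)^T | i <- enum 'I_m].

End Projection.

Section ProjectionCorrect.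
Variable R : realType.

Definition inner n (x y : 'cV[R]_n) : R := \sum_i x i 0 * y i 0.

Lemma innerE n (x y : 'cV[R]_n) : inner x y = (x^T *m y) 0 0.
Proof. by rewrite mxE; apply: eq_bigr => i _; rewrite mxE. Qed.

Lemma innerC n (x y : 'cV[R]_n) : inner x y = inner y x.
Proof. by apply: eq_bigr => i _; rewrite mulrC. Qed.

Lemma tsubscaleE n (y x : 'cV[R]_n) a :
  value (tsubscale y a x) = y - a *: x.
Proof. by apply/colP => i; rewrite !mxE. Qed.

Lemma innerBZ n (w x y : 'cV[R]_n) a :
  inner w (x - a *: y) = inner w x - a * inner w y.
Proof. by rewrite !innerE mulmxBr -scalemxAr !mxE. Qed.

Lemma inner_eq0 n (x : 'cV[R]_n) : (inner x x == 0) = (x == 0).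
Proof.
apply/eqP/eqP => [|->]; last by rewrite innerE mulmx0 mxE.
rewrite innerE => x0; apply: trmx_inj; rewrite trmx0; apply: mulmx_tr_eq0.
by rewrite trmxK [LHS]mx11_scalar x0 -scalemx1 scale0r.
Qed.

Fixpoint orthogonal n (ws : seq 'cV[R]_n) : Prop :=
  if ws is w :: ws' then
    [/\ w != 0, {in ws', forall u, inner w u = 0} & orthogonal ws']
  else True.

Lemma tproj_cons n (w : 'cV[R]_n) ws x : value (tproj (w :: ws) x) =
  value (tproj ws (x - (inner w x / inner w w) *: w)).
Proof. by rewrite /= -tsubscaleE. Qed.

Lemma tproj_keep n (ws : seq 'cV[R]_n) u x :
  {in ws, forall w, inner u w = 0} -> inner u (value (tproj ws x)) = inner u x.
Proof.
elim: ws x => [//|w ws IHws] x uws; rewrite tproj_cons IHws => [|v vws].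
  by rewrite innerBZ (uws w) ?mem_head // mulr0 subr0.
by rewrite uws // inE vws orbT.
Qed.

Lemma tproj_orth n (ws : seq 'cV[R]_n) x : orthogonal ws ->
  {in ws, forall w, inner w (value (tproj ws x)) = 0}.
Proof.
elim: ws x => [//|w ws IHws] x /= [w0 wws ows] u; rewrite inE => /orP[/eqP->|uws].
  rewrite -/(tproj (w :: ws) x) tproj_cons tproj_keep // innerBZ divfK ?subrr //.
  by rewrite inner_eq0.
by rewrite -/(tproj (w :: ws) x) tproj_cons IHws.
Qed.

Definition in_rows m n (A : 'M[R]_(m, n)) (x : 'cV[R]_n) :=
  exists t : 'cV[R]_m, x = A^T *m t.

Lemma tproj_rows m n (A : 'M[R]_(m, n)) ws x : {in ws, forall w, in_rows A w} ->
  in_rows A (x - value (tproj ws x)).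
Proof.
elim: ws x => [|w ws IHws] x Aws; first by exists 0; rewrite mulmx0 /= subrr.
have [|t tE] := IHws (x - (inner w x / inner w w) *: w).
  by move=> u uws; apply: Aws; rewrite inE uws orbT.
have [s sE] := Aws w (mem_head _ _); exists (t + (inner w x / inner w w) *: s).
rewrite mulmxDr -scalemxAr -sE -tE tproj_cons.
by rewrite addrAC subrK.
Qed.

Lemma gram_schmidtP m n (A : 'M[R]_(m, n)) ws rs :
    orthogonal ws -> {in ws ++ rs, forall w, in_rows A w} ->
  let bs := value (gram_schmidt ws rs) in
  [/\ orthogonal bs, {in bs, forall w, in_rows A w} &
      forall x, {in bs, forall w, inner w x = 0} ->
        {in ws ++ rs, forall w, inner w x = 0}].
Proof.
elim: rs ws => [|r rs IHrs] ws ows Aws.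
  by rewrite cats0 in Aws *; split.
rewrite /= -[[set i | _]]/([set i | value (tproj ws r) i 0 != 0]).
set w := value (tproj ws r); set S := [set i | _].
have Ar : in_rows A r by apply: Aws; rewrite mem_cat mem_head orbT.
have Aws1 : {in ws, forall w, in_rows A w}.
  by move=> u uws; apply: Aws; rewrite mem_cat uws.
have Ars : {in rs, forall w, in_rows A w}.
  by move=> u urs; apply: Aws; rewrite mem_cat inE urs !orbT.
have Aw : in_rows A w.
  have [t tE] := tproj_rows r Aws1; have [s sE] := Ar.
  by exists (s - t); rewrite mulmxBr -tE -sE opprB addrC subrK.
(* r - w is a combination of ws *)
have rw x : {in ws, forall u, inner u x = 0} -> inner r x = inner w x.
  rewrite /w; elim: (ws) (r) => [//|u us IHus] q xus.
  rewrite tproj_cons -IHus => [|v vus]; last by rewrite xus // inE vus orbT.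
  by rewrite innerC [RHS]innerC innerBZ [inner x u]innerC (xus u) ?mem_head //
     mulr0 subr0.
have wE : (S == set0) = (w == 0).
  apply/eqP/eqP => [S0|w0]; last first.
    by apply/setP => i; rewrite !inE w0 mxE eqxx.
  apply/colP => i; rewrite mxE; apply/eqP; apply: contraT => wi.
  have : i \in S by rewrite inE.
  by rewrite S0 inE.
rewrite wE; case: (eqVneq w 0) => [w0|w0].
  have [|obs Abs sub] := IHrs ws ows.
    by move=> u; rewrite mem_cat => /orP[/Aws1|/Ars].
  split=> // x xbs u; have := sub x xbs.
  rewrite !mem_cat inE => sub' /or3P[uws|/eqP->|urs].
  - by apply: sub'; rewrite mem_cat uws.
  - rewrite rw ?w0 ?innerE ?trmx0 ?mul0mx ?mxE // => v vws.
    by apply: sub'; rewrite mem_cat vws.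
  - by apply: sub'; rewrite mem_cat urs orbT.
have [||obs Abs sub] := IHrs (w :: ws).
- split=> // u uws; rewrite innerC; exact: tproj_orth.
- move=> u; rewrite /= inE mem_cat => /or3P[/eqP->//|/Aws1//|/Ars//].
split=> // x xbs u; have := sub x xbs.
rewrite !mem_cat inE => sub' /or3P[uws|/eqP->|urs].
- by apply: sub'; rewrite /= inE mem_cat uws orbT.
- rewrite rw => [|v vws]; first by apply: sub'; rewrite mem_head.
  by apply: sub'; rewrite /= inE mem_cat vws orbT.
- by apply: sub'; rewrite /= inE mem_cat urs !orbT.
Qed.

Lemma row_basisP m n (A : 'M[R]_(m, n)) (x : 'cV[R]_n) :
  value (tproj (value (row_basis A)) x) = Pproj A *m x.
Proof.
have [//||ob Ab sub] := @gram_schmidtP _ _ A [::] [seq (row i A)^T | i <- enum 'I_m].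
  move=> u /mapP[i _ ->]; exists (delta_mx i 0).
  by apply: trmx_inj; rewrite trmx_mul !trmxK trmx_delta rowE.
rewrite -/(row_basis A) in ob Ab sub *.
set bs := value _ in ob Ab sub *; set p := value _.
have Ap : A *m p = 0.
  apply/colP => i; rewrite [RHS]mxE -(sub p (tproj_orth x ob) (row i A)^T).
    by rewrite innerE trmxK -row_mul [RHS]mxE.
  by apply/mapP; exists i; rewrite ?mem_enum.
have [t tE] := tproj_rows x Ab; rewrite -/p in tE.
pose s : 'cV_m := pinv (A *m A^T) *m A *m x.
have PE : x - Pproj A *m x = A^T *m s.
  by rewrite /Pproj /Qproj mulmxBl mul1mx opprB addrCA subrr addr0 !mulmxA.
have dE : p - Pproj A *m x = A^T *m (s - t).
  by rewrite mulmxBr -tE -PE opprB [RHS]addrC addrA subrK.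
have : A *m (p - Pproj A *m x) = 0.
  by rewrite mulmxBr Ap mulmxA mulmx_Pproj mul0mx subrr.
rewrite dE => d0; apply/eqP; rewrite -subr_eq0 dE; apply/eqP.
apply: trmx_inj; rewrite trmx0; apply: mulmx_tr_eq0.
by rewrite trmxK trmx_mul trmxK -mulmxA d0 mulmx0.
Qed.

End ProjectionCorrect.

Section BasicProcedure.
Variable R : realType.

Inductive bp_result n : Type :=
| Case2 of 'cV[R]_n & 'cV[R]_n
| Case1 of 'cV[R]_n & 'cV[R]_n
| Case0 of 'cV[R]_n & 'cV[R]_n & {set 'I_n}.

Record bp_state n := BpState { bp_y : 'cV[R]_n; bp_z : 'cV[R]_n; bp_v : 'cV[R]_n }.

Definition tbound n (z : 'cV[R]_n) (j : 'I_n) : timed R :=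
  tsum (fun i =>
    let* s := fopp (z j 0) in
    let* q := fdiv (z i 0) s in
    fmax 0 q).

Definition tcandidates n (z : 'cV[R]_n) : timed {set 'I_n} :=
  tset (fun j =>
    let* b := fis0 (z j 0) in
    if b then ret false
    else let* t := tbound z j in let* h := fdiv 1 2 in fle t h).

(* The rule by which an implementation of the procedure picks the nonempty set
   J, given P_A (stored as above), y and z. *)
Definition selection_rule :=
  forall n, seq 'cV[R]_n -> 'cV[R]_n -> 'cV[R]_n -> {set 'I_n}.

Definition admissible (sel : selection_rule) : Prop :=
  forall n (ws : seq 'cV[R]_n) (y z : 'cV[R]_n),
    value (tcandidates z) != set0 ->
    sel n ws y z != set0 /\ sel n ws y z \subset value (tcandidates z).

(* 1 / (2 n^(3/2)) *)
Definition tthreshold n : timed R :=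
  let* s := fsqrt n%:R in
  let* t := fmul n%:R s in
  let* u := fmul 2 t in
  fdiv 1 u.

Definition bp_init n (ws : seq 'cV[R]_n) : timed (bp_state n) :=
  let* y := tvec (fun _ => fdiv 1 n%:R) in
  let* z := tproj ws y in
  let* v := tsubscale y 1 z in
  ret (BpState y z v).

Definition bp_iter (c : R) (sel : selection_rule) n (ws : seq 'cV[R]_n)
    (threshold : R) (s : bp_state n) : timed (bp_state n + bp_result n) :=
  let: BpState y z v := s in
  let* Vpos := tset (fun i => flt 0 (v i 0)) in
  if Vpos == setT then ret (inr (Case2 y z)) else
  let* Zge0 := tset (fun i => fle 0 (z i 0)) in
  if Zge0 == setT then ret (inr (Case1 y z)) else
  let* K := tset (fun i => fle (z i 0) 0) in
  let eK := \col_i (i \in K)%:R in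
  let* p := tproj ws eK in
  let* nu := tnorm p in
  let* pn := tvec (fun i => fdiv (p i 0) nu) in
  let* alpha := tdot pn z in
  let* mt := fopp threshold in
  let* b := fle alpha mt in
  if b then
    let* r := fdiv alpha nu in
    let* a := fmul c r in
    let* y' := tsubscale y a eK in
    let* z' := tsubscale z a p in
    let* v' := tsubscale y' 1 z' in
    ret (inl (BpState y' z' v'))
  else
    let* C := tcandidates z in
    ret (inr (Case0 y z (sel n ws y z))).

Inductive bp_loop (c : R) (sel : selection_rule) n (ws : seq 'cV[R]_n)
    (threshold : R) : bp_state n -> bp_result n -> nat -> Prop :=
| BpReturn s r :
    value (bp_iter c sel ws threshold s) = inr r ->
    bp_loop c sel ws threshold s r (cost (bp_iter c sel ws threshold s))
| BpContinue s s' r k :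
    value (bp_iter c sel ws threshold s) = inl s' ->
    bp_loop c sel ws threshold s' r k ->
    bp_loop c sel ws threshold s r (cost (bp_iter c sel ws threshold s) + k).

(* [basic_procedure c sel ws r k]: the procedure halts with result r after k
   operations. *)
Definition basic_procedure (c : R) (sel : selection_rule) n
    (ws : seq 'cV[R]_n) (r : bp_result n) (k : nat) : Prop :=
  let T := tthreshold n in
  let S := bp_init ws in
  exists k', bp_loop c sel ws (value T) (value S) r k' /\
             k = (cost T + cost S + k')%N.

End BasicProcedure.

Section MainAlgorithm.
Variable R : realType.

Inductive outcome n : Type :=
| DualFeasible
| PrimalFeasible of 'cV[R]_n.

Definition rescale m n (bigT : R) (J : {set 'I_n}) (A : 'M[R]_(m, n))
    (d : 'cV[R]_n) : timed ('M[R]_(m, n) * 'cV[R]_n) :=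
  let* d' := tvec (fun j => if j \in J then fmul 2 (d j 0) else ret (d j 0)) in
  let* A' := tmat (fun i j => if j \in J then fmul 2 (A i j) else ret (A i j)) in
  let* H := tset (fun j => fle bigT (d' j 0)) in
  ret (\matrix_(i, j) (if j \in H then 0 else A' i j),
       \col_j (if j \in H then 0 else d' j 0)).

(* One iteration with case = 0 takes A and d to A' and d' in k operations;
   bigT is 2^L. *)
Definition main_iter (c : R) (sel : selection_rule R) (bigT : R) m n
    (A : 'M[R]_(m, n)) (d : 'cV[R]_n) (A' : 'M[R]_(m, n)) (d' : 'cV[R]_n)
    (k : nat) : Prop :=
  let B := row_basis A in
  exists y z J k',
    let U := rescale bigT J A d in
    [/\ basic_procedure c sel (value B) (Case0 y z J) k',
        value U = (A', d') & k = (cost B + k' + cost U)%N].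

Inductive main_iters (c : R) (sel : selection_rule R) (bigT : R) m n :
    'M[R]_(m, n) -> 'cV[R]_n -> 'M[R]_(m, n) -> 'cV[R]_n -> nat -> Prop :=
| ItersNil A d : main_iters c sel bigT A d A d 0
| ItersCons A d A1 d1 A2 d2 k k' :
    main_iter c sel bigT A d A1 d1 k ->
    main_iters c sel bigT A1 d1 A2 d2 k' ->
    main_iters c sel bigT A d A2 d2 (k + k').

(* The last iteration, with case = 1 or 2, and the output. *)
Inductive main_exit (c : R) (sel : selection_rule R) m n
    (A : 'M[R]_(m, n)) (d : 'cV[R]_n) : outcome n -> nat -> Prop :=
| ExitCase2 (y z : 'cV_n) k :
    let B := row_basis A in
    basic_procedure c sel (value B) (Case2 y z) k ->
    main_exit c sel A d (DualFeasible n) (cost B + k)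
| ExitCase1 (y z : 'cV_n) k :
    let B := row_basis A in
    let X := tvec (fun j => fmul (d j 0) (z j 0)) in
    basic_procedure c sel (value B) (Case1 y z) k ->
    main_exit c sel A d (PrimalFeasible (value X)) (cost B + k + cost X).

Definition scale_limit m n (A : 'M[rat]_(m, n)) : timed R := fpow 2 (bit_size A).

(* On input A the algorithm halts with outcome r after k operations. *)
Definition dual_algorithm (c : R) (sel : selection_rule R) m n
    (A : 'M[rat]_(m, n)) (r : outcome n) (k : nat) : Prop :=
  exists A' d' k1 k2,
    [/\ main_iters c sel (value (scale_limit A)) (map_mx ratr A) (const_mx 1) A' d' k1,
        main_exit c sel A' d' r k2 & k = (cost (scale_limit A) + k1 + k2)%N].

(* After k operations the while loop reaches a state that an iteration with
   case = 0 reproduces, so that it never ends.  This does occur, with J among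
   the columns that have been replaced by zero: if A = [0 3 4], then J = {1} is
   the only possible choice in every iteration, for all c, and once d_1 = 0
   nothing changes any more. *)
Definition dual_algorithm_stalls (c : R) (sel : selection_rule R) m n
    (A : 'M[rat]_(m, n)) (k : nat) : Prop :=
  exists A' d' k1 k2,
    [/\ main_iters c sel (value (scale_limit A)) (map_mx ratr A) (const_mx 1) A' d' k1,
        main_iter c sel (value (scale_limit A)) A' d' A' d' k2 &
        k = (cost (scale_limit A) + k1)%N].

End MainAlgorithm.

(* Main.v *)
(* Each update step of the basic procedure lowers |z|^2,
   which starts at most at 1/n, by at least c (2 - c) / (4 n^3); so there are
   O(n^2) steps of O(mn) operations.  When the procedure returns with case = 0,
   the negative entries of z add up to more than -1/(2n), while v_j <= 0 for
   some j forces z_j >= y_j >= 1/n, hence bound'_j <= 1/2: J can be chosen.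

   In the main loop, d_j = 2^(e_j) with e_j <= L (and e_j = L standing for
   d_j = 0).  An iteration that changes the state increases the sum of the e_j,
   which is at most nL; an iteration that does not change it repeats for ever.

   If the dual is feasible, every x in the row space of A with 0 <= x <= 1
   keeps diag(d) x <= 1, since x is orthogonal to z and so x_j <= bound'_j.  By
   Cramer's rule at a vertex of {u | A^T u >= 1}, some such x has all its
   entries above 2^(-L).  Then no column is ever replaced by zero, and every
   iteration doubles some d_j. *)
Require Import Defs.
From mathcomp Require Import all_boot all_order all_algebra.
From mathcomp Require Import reals.
From mathcomp Require Import perm zify ring lra.
Import Order.TTheory GRing.Theory Num.Theory.
Local Open Scope ring_scope.
Set Implicit Arguments.
Unset Strict Implicit.
Unset Printing Implicit Defensive.

(** * Inner products and the orthogonal projection *)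

Section Inner.
Variables (R : realType) (n : nat).
Implicit Types x y z p : 'cV[R]_n.

Lemma inner_ge0 x : 0 <= inner x x.
Proof. by apply: sumr_ge0 => i _; rewrite -expr2 sqr_ge0. Qed.

Lemma inner_subscale x p a : inner (x - a *: p) (x - a *: p) =
  inner x x - a * inner p x *+ 2 + a ^+ 2 * inner p p.
Proof.
rewrite innerBZ ![inner (x - _) _]innerC !innerBZ (innerC x p).
by ring.
Qed.

Lemma inner_indic_le (S : {set 'I_n}) :
  inner (\col_i (i \in S)%:R) (\col_i (i \in S)%:R) <= n%:R :> R.
Proof.
rewrite -[X in _ <= X%:R](card_ord n) -sum1_card natr_sum; apply: ler_sum => i _.
by rewrite !mxE; case: (i \in S); rewrite ?mulr1 ?mulr0.
Qed.

Lemma inner_indic (S : {set 'I_n}) z :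
  inner (\col_i (i \in S)%:R) z = \sum_(i in S) z i 0.
Proof.
rewrite [RHS]big_mkcond; apply: eq_bigr => i _; rewrite mxE.
by case: (i \in S); rewrite ?mul1r ?mul0r.
Qed.

Variables (m : nat) (A : 'M[R]_(m, n)).

Lemma inner_in_rows z x : A *m z = 0 -> in_rows A x -> inner z x = 0.
Proof.
by move=> Az [t ->]; rewrite innerC innerE trmx_mul trmxK -mulmxA Az mulmx0 mxE.
Qed.

(** The difference between [y] and its projection lies in the row space, hence is orthogonal to the
    projection of [x]. *)
Lemma inner_Pproj x y :
  inner (Pproj A *m x) (Pproj A *m y) = inner (Pproj A *m x) y.
Proof.
apply/eqP; rewrite -subr_eq0 -opprB oppr_eq0; apply/eqP.
rewrite -[inner _ (Pproj A *m y)]mul1r -innerBZ scale1r.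
apply: inner_in_rows; first by rewrite mulmxA mulmx_Pproj mul0mx.
exists (pinv (A *m A^T) *m A *m y).
by rewrite /Pproj /Qproj mulmxBl mul1mx opprB addrC subrK !mulmxA.
Qed.

(** Expand the nonnegative squared norm of [x - Pproj A *m x]; by [inner_Pproj] the cross term is
    the squared norm of the projection. *)
Lemma inner_Pproj_le x : inner (Pproj A *m x) (Pproj A *m x) <= inner x x.
Proof.
have := inner_ge0 (x - 1 *: (Pproj A *m x)).
rewrite inner_subscale -inner_Pproj; lra.
Qed.

End Inner.

(** * Cost of one projection *)

Lemma size_row_basis (R : realType) m n (A : 'M[R]_(m, n)) :
  (size (value (row_basis A)) <= m)%N.
Proof.
rewrite /row_basis.
have gs (ws rs : seq 'cV[R]_n) :
    (size (value (gram_schmidt ws rs)) <= size ws + size rs)%N.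
  elim: rs ws => [|r rs IHrs] ws /=; first by rewrite addn0.
  by apply: leq_trans (IHrs _) _; case: ifP => _ /=; rewrite addnS ?addSn.
by apply: leq_trans (gs _ _) _; rewrite size_map -cardE card_ord.
Qed.

Lemma cost_tproj (R : realType) n (ws : seq 'cV[R]_n) x :
  cost (tproj ws x) = (size ws * (6 * n).+1)%N.
Proof.
elim: ws x => [//|w ws IHws] x; rewrite /= IHws !sum_nat_const card_ord mulSn.
lia.
Qed.

(** * The basic procedure: decrease of the norm, choice of J, and cost *)

Section BasicProcedure.
Variables (R : realType) (c : R) (sel : selection_rule R).
Hypotheses (hc : 0 < c < 2) (sel_adm : admissible sel).
Variables (m n : nat) (A : 'M[R]_(m, n)).
Hypotheses (n_gt0 : (0 < n)%N) (m_gt0 : (0 < m)%N).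

Let ws := value (row_basis A).
Let threshold : R := value (tthreshold R n).
Let nR : R := n%:R.

Lemma thresholdE : threshold = (2 * (nR * Num.sqrt nR))^-1.
Proof. by rewrite /threshold /= div1r. Qed.

Lemma threshold_gt0 : 0 < threshold.
Proof. by rewrite thresholdE invr_gt0 !mulr_gt0 ?sqrtr_gt0 ?ltr0n. Qed.

(** The lower bound on [y] persists because each update adds a nonnegative multiple of an indicator
    vector; it is what makes some bound small when the procedure returns with case 0. *)
Definition bp_inv (s : bp_state R n) :=
  [/\ bp_z s = Pproj A *m bp_y s, bp_v s = bp_y s - bp_z s &
      forall i, nR^-1 <= bp_y s i 0].

Lemma bp_init_inv : bp_inv (value (bp_init ws)).
Proof.
split=> /=; first by rewrite row_basisP.
  by apply/colP => i; rewrite !mxE !mul1r.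
by move=> i; rewrite mxE div1r.
Qed.

Lemma bp_init_norm : let z := bp_z (value (bp_init ws)) in
  inner z z <= nR^-1.
Proof.
rewrite /= row_basisP; apply: le_trans (inner_Pproj_le _ _) _.
rewrite /inner (eq_bigr (fun=> nR^-1 * nR^-1)) => [|i _].
  rewrite sumr_const card_ord -mulr_natl mulrA divff ?mul1r //.
  by rewrite pnatr_eq0 -lt0n.
by rewrite !mxE div1r.
Qed.

(** With step c alpha / nu along [p], where nu is the norm of [p], the squared norm of z changes by
    exactly - c (2 - c) alpha^2, and alpha <= - threshold. *)
Lemma bp_iter_continue s s' : bp_inv s ->
    value (bp_iter c sel ws threshold s) = inl s' ->
  bp_inv s' /\
  inner (bp_z s') (bp_z s') <=
    inner (bp_z s) (bp_z s) - c * (2 - c) * threshold ^+ 2.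
Proof.
case: s => y z v [/= zE vE yn]; rewrite /bp_iter /=.
set S1 := [set i | _]; case: (S1 == setT) => //=.
set S2 := [set i | _]; case: (S2 == setT) => //=.
set K := [set i | _]; set eK := \col_i (i \in K)%:R.
set p := value (tproj ws eK); set nu := Num.sqrt _; set alpha := \sum_i _.
case: ifP => //= alpha_le [<-] /=; rewrite /bp_inv /=.
have [c_gt0 c_lt2] := andP hc.
have tau0 := threshold_gt0.
have pE : p = Pproj A *m eK by exact: row_basisP.
have alphaE : alpha = inner p z / nu.
  by rewrite /alpha mulr_suml; apply: eq_bigr => i _; rewrite mxE mulrAC.
(* Division by zero yields 0, so nu = 0 would give alpha = 0 > - threshold. *)
have nu0 : nu != 0.
  by apply: contraTneq alpha_le => nu0; rewrite alphaE nu0 invr0 mulr0 lerNr oppr0 -ltNge.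
have nu2 : inner p p = nu ^+ 2 by rewrite sqr_sqrtr // inner_ge0.
have nu_gt0 : 0 < nu by rewrite lt0r nu0 sqrtr_ge0.
rewrite -![\col_i (_ - _ * _)]/(value (tsubscale _ _ _)) !tsubscaleE scale1r.
split.
  split=> //; first by rewrite zE pE mulmxBr -scalemxAr.
  move=> i; rewrite !mxE; apply: le_trans (yn i) _.
  rewrite lerDl oppr_ge0 mulr_le0_ge0 ?ler0n // mulr_ge0_le0 ?(ltW c_gt0) //.
  by rewrite mulr_le0_ge0 ?invr_ge0 ?(ltW nu_gt0) //; lra.
have pz : inner p z = alpha * nu by rewrite alphaE divfK.
rewrite inner_subscale nu2 pz.
have -> : inner z z - c * (alpha / nu) * (alpha * nu) *+ 2 +
    (c * (alpha / nu)) ^+ 2 * nu ^+ 2 = inner z z - c * (2 - c) * alpha ^+ 2.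
  by field.
have sq : threshold ^+ 2 <= alpha ^+ 2 by nra.
have c2 : 0 <= c * (2 - c) by nra.
nra.
Qed.

Lemma bp_iter_case0 s y z J : bp_inv s ->
    value (bp_iter c sel ws threshold s) = inr (Case0 y z J) ->
  [/\ z = Pproj A *m y, J != set0 & J \subset value (tcandidates z)].
Proof.
case: s => y0 z0 v [/= zE vE yn]; rewrite /bp_iter /=.
set S1 := [set i | _]; case: ifP => //= S1T.
set S2 := [set i | _]; case: ifP => //= S2T.
set K := [set i | _]; set eK := \col_i (i \in K)%:R.
set p := value (tproj ws eK); set nu := Num.sqrt _; set alpha := \sum_i _.
case: ifP => //= alpha_le [<- <- <-].
suff cand0 : value (tcandidates z0) != set0.
  by have [] := sel_adm ws y0 cand0.
have pE : p = Pproj A *m eK by exact: row_basisP.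
have alphaE : alpha = inner p z0 / nu.
  by rewrite /alpha mulr_suml; apply: eq_bigr => i _; rewrite mxE mulrAC.
have nu2 : inner p p = nu ^+ 2 by rewrite sqr_sqrtr // inner_ge0.
(* [z0] is itself a projection, so projecting the indicator of [K] does not affect its inner product
   with [z0]. *)
have pz : inner p z0 = \sum_(i in K) z0 i 0.
  by rewrite pE zE innerC inner_Pproj innerC -zE inner_indic.
have pz_lt0 : inner p z0 < 0.
  have [i zi] : exists i, z0 i 0 < 0.
    have /subsetPn[i _] : ~~ (setT \subset S2) by rewrite subTset S2T.
    by rewrite inE -ltNge; exists i.
  rewrite pz (bigD1 i) /=; last by rewrite inE ltW.
  by rewrite -[X in _ < X]addr0 ltr_leD //; apply: sumr_le0 => k /andP[]; rewrite inE.
have nu_gt0 : 0 < nu.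
  rewrite lt0r sqrtr_ge0 andbT; apply: contraTneq pz_lt0 => nu0.
  have /eqP : inner p p = 0 by rewrite nu2 nu0 expr0n.
  by rewrite inner_eq0 => /eqP ->; rewrite innerE trmx0 mul0mx mxE ltxx.
have n0 : 0 < nR by rewrite ltr0n.
have nu_le : nu <= Num.sqrt nR.
  by rewrite ler_wsqrtr // (le_trans _ (inner_indic_le _ K)) // -/p pE inner_Pproj_le.
(* The factor sqrt n bounding [nu] cancels the one in the threshold. *)
have pz_ge : - inner p z0 <= (2 * nR)^-1.
  have : - threshold <= inner p z0 / nu by rewrite -alphaE ltW // ltNge alpha_le.
  rewrite ler_pdivlMr // mulNr lerNl => /le_trans; apply.
  rewrite (le_trans (ler_wpM2l _ nu_le)) ?thresholdE ?invr_ge0 ?mulr_ge0 ?sqrtr_ge0 ?(ltW n0) //.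
  by rewrite mulrA invfM divfK // gt_eqF // sqrtr_gt0.
have /subsetPn[j _ vj] : ~~ (setT \subset S1) by rewrite subTset S1T.
rewrite inE -leNgt vE !mxE subr_le0 in vj.
have zj : nR^-1 <= z0 j 0 by exact: le_trans (yn j) vj.
have zj0 : 0 < z0 j 0 by rewrite (lt_le_trans _ zj) // invr_gt0.
apply/set0Pn; exists j; rewrite inE /= (gt_eqF zj0) /= div1r.
(* Since z_j > 0, exactly the indices in [K] have nonnegative quotients; all other terms are cut to
   0. *)
have -> : \sum_i Num.max 0 (z0 i 0 / - z0 j 0) = - inner p z0 / z0 j 0.
  rewrite pz mulNr mulr_suml -sumrN [RHS]big_mkcond /=; apply: eq_bigr => i _.
  rewrite inE invrN mulrN; case: ifP => zi.
    by rewrite max_r // oppr_ge0 mulr_le0_ge0 // invr_ge0 ltW.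
  by rewrite max_l // oppr_le0 divr_ge0 ?ltW // ltNge zi.
rewrite ler_pdivrMr // (le_trans pz_ge) // invfM.
by rewrite ler_wpM2l // invr_ge0.
Qed.

(** The quadratic term pays for the candidate set, which is computed only on a return with case 0,
    hence at most once per call; it must not be multiplied by the number of updates. *)
Lemma cost_bp_iter s : 
  (cost (bp_iter c sel ws threshold s) <= 50 * (m * n) + 
    (if value (bp_iter c sel ws threshold s) is inl _ then 0 else 7 * n ^ 2))%N.
Proof.
case: s => y z v; rewrite /bp_iter /=.
set S1 := [set i | _]; case: ifP => _ /=; first by rewrite sum_nat_const card_ord; nia.
set S2 := [set i | _]; case: ifP => _ /=.
  by rewrite !sum_nat_const card_ord; nia.
have := size_row_basis A; rewrite -/ws => ws_le.
have tp_le x : (cost (tproj ws x) <= 7 * (m * n))%N by rewrite cost_tproj; nia.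
have n_le : (n <= m * n)%N by exact: leq_pmull.
move: (tp_le (\col_i (i \in [set i | z i 0 <= 0])%:R)); set t := cost _ => t_le.
case: ifP => _ /=; rewrite !sum_nat_const !card_ord; first lia.
rewrite -/t.
have cand_le : (\sum_(i < n) (1 + cost (if z i 0%R == 0%R then ret false
     else let* t := tbound z i in let* h := fdiv 1 2 in fle t h))
    <= \sum_(i < n) (4 * n + 3))%N.
  apply: leq_sum => i _; case: ifP => _ /=; first lia.
  by rewrite sum_nat_const card_ord; lia.
rewrite sum_nat_const card_ord in cand_le.
move: cand_le; set cand := (\sum_(i < n) _)%N; move: cand => cand cand_le.
nia.
Qed.

Lemma bp_loop_inv s r k : bp_loop c sel ws threshold s r k ->
  match value (bp_iter c sel ws threshold s) with
  | inr r' => r = r' /\ k = cost (bp_iter c sel ws threshold s)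
  | inl s' => exists2 k', bp_loop c sel ws threshold s' r k' &
      k = (cost (bp_iter c sel ws threshold s) + k')%N
  end.
Proof. by case=> {s r k} [s r | s s' r k] -> // loop; exists k. Qed.

Lemma bp_loop_det s r r' k k' :
  bp_loop c sel ws threshold s r k -> bp_loop c sel ws threshold s r' k' ->
  r = r' /\ k = k'.
Proof.
move=> loop; elim: loop r' k' => {s r k} [s r E|s s' r k E _ IH] r' k'
  /bp_loop_inv; rewrite E; first by case=> -> ->.
by case=> k2 /IH[-> ->] ->.
Qed.

(** Determinism carries the cost bound of the one run constructed below over to every run. *)
Lemma basic_procedure_det r r' k k' :
  basic_procedure c sel ws r k -> basic_procedure c sel ws r' k' ->
  r = r' /\ k = k'.
Proof.
by move=> [k1 [loop1 ->]] [k2 [loop2 ->]]; have [-> ->] := bp_loop_det loop1 loop2.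
Qed.

Lemma basic_procedure_case0 y z J k :
  basic_procedure c sel ws (Case0 y z J) k ->
  [/\ z = Pproj A *m y, J != set0 & J \subset value (tcandidates z)].
Proof.
case=> k' [+ _]; move: bp_init_inv; set s := value _; set r := Case0 _ _ _.
move=> + loop; have : r = Case0 y z J by [].
elim: loop => {s r} [s r sr rE inv_s | s s' r k'' ss' _ IH rE inv_s].
  by apply: (bp_iter_case0 inv_s); rewrite sr rE.
by apply: IH => //; have [] := bp_iter_continue inv_s ss'.
Qed.

(** [N] bounds the number of updates still possible, since each lowers the squared norm of z by at
    least the fixed drop. At N = 0 an update would make that norm negative. *)
Lemma bp_loop_exists N s : bp_inv s ->
    inner (bp_z s) (bp_z s) <= N%:R * (c * (2 - c) * threshold ^+ 2) ->
  exists r k, bp_loop c sel ws threshold s r k /\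
    (k <= N * (50 * (m * n)) + 50 * (m * n) + 7 * n ^ 2)%N.
Proof.
have n0 : 0 < nR by rewrite ltr0n.
have drop_gt0 : 0 < c * (2 - c) * threshold ^+ 2.
  have [c_gt0 c_lt2] := andP hc.
  by rewrite mulr_gt0 ?exprn_gt0 ?threshold_gt0 // mulr_gt0 ?subr_gt0.
elim: N s => [|N IH] s inv_s z_le; have := cost_bp_iter s;
  case E: (value (bp_iter c sel ws threshold s)) => [s'|r] cost_le.
- have [_ z'_le] := bp_iter_continue inv_s E.
  by have := inner_ge0 (bp_z s'); rewrite mul0r in z_le; lra.
- by exists r; eexists; split; [exact: BpReturn E | lia].
- have [inv_s' z'_le] := bp_iter_continue inv_s E.
  have [|r [k [loop k_le]]] := IH s' inv_s'; first by rewrite mulrS mulrDl mul1r in z_le; lra.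
  by exists r; eexists; split; [exact: BpContinue E loop | lia].
- by exists r; eexists; split; [exact: BpReturn E | lia].
Qed.

(** The drop per update is c (2 - c) / (4 n^3) and the initial squared norm is at most 1/n, so C0
    n^2 updates suffice. *)
Lemma basic_procedure_exists (C0 : nat) : 4 / (c * (2 - c)) <= C0%:R ->
  exists r k, basic_procedure c sel ws r k /\
    (k <= (50 * C0 + 80) * (n ^ 3 * m))%N.
Proof.
move=> C0_ge; have n0 : 0 < nR by rewrite ltr0n.
have [c_gt0 c_lt2] := andP hc.
have [|r [k [loop k_le]]] := @bp_loop_exists (C0 * n ^ 2) _ bp_init_inv.
  apply: le_trans bp_init_norm _.
  rewrite thresholdE exprVn !exprMn sqr_sqrtr ?(ltW n0) //.
  rewrite ler_pdivrMr ?mulr_gt0 ?subr_gt0 // in C0_ge.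
  rewrite natrM natrX -/nR.
  have -> : C0%:R * nR ^+ 2 * (c * (2 - c) * (2 ^+ 2 * (nR ^+ 2 * nR))^-1) =
     (C0%:R * (c * (2 - c)) / 4) / nR by field; rewrite gt_eqF.
  by rewrite ler_peMl ?invr_ge0 ?(ltW n0) // ler_pdivlMr ?ltr0n // mul1r.
exists r; eexists; split; first by exists k; split; [exact: loop|].
have := size_row_basis A; rewrite -/ws => ws_le.
rewrite /= cost_tproj !sum_nat_const !card_ord.
have n1 : (n * m <= n ^ 3 * m)%N by rewrite leq_mul2r expnS leq_pmulr ?orbT // expn_gt0 n_gt0.
have n2 : (n ^ 2 <= n ^ 3 * m)%N by rewrite -[X in (X <= _)%N]muln1 leq_mul // leq_pexp2l.
nia.
Qed.
End BasicProcedure.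

(** Solving the orthogonality of z and x for x_j gives x_j as the sum of (z_i / - z_j) x_i over i
    distinct from j; as x_i lies in [0, 1], this is at most the sum of the positive parts, that is
    bound'_j. *)
Lemma candidates_le_half (R : realType) m n (A : 'M[R]_(m, n)) (z x : 'cV[R]_n) j :
    A *m z = 0 -> in_rows A x -> (forall i, 0 <= x i 0 <= 1) ->
  j \in value (tcandidates z) -> x j 0 <= 1 / 2.
Proof.
move=> Az Ax x01; rewrite inE /=; case: eqVneq => [//|zj0] /=; apply: le_trans.
have : \sum_i z i 0 / - z j 0 * x i 0 = 0.
  transitivity (inner z x / - z j 0); last by rewrite (inner_in_rows Az Ax) mul0r.
  rewrite mulr_suml.
  by apply: eq_bigr => i _; rewrite mulrAC.
have zjj : z j 0 / - z j 0 = -1 by rewrite invrN mulrN divff.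
rewrite (bigD1 j) //= zjj mulN1r addrC => /subr0_eq <-.
rewrite [X in _ <= X](bigD1 j) //= -[X in X <= _]add0r lerD ?le_max ?lexx //.
apply: ler_sum => i _; have /andP[x0 x1] := x01 i.
case: (leP 0 (z i 0 / - z j 0)) => [q0|/ltW q0]; last by rewrite mulr_le0_ge0.
by rewrite -[leRHS]mulr1 ler_wpM2l.
Qed.

Lemma sum_ord_leq n (F : 'I_n -> nat) k :
  (forall i, F i <= k)%N -> (\sum_i F i <= n * k)%N.
Proof.
move=> Fk; apply: (@leq_trans (\sum_(i < n) k)%N); first exact: leq_sum.
by rewrite sum_nat_const card_ord.
Qed.

(** * The rescaling step in terms of exponents *)

Section Exponents.
Variables (R : realType) (m n L : nat) (A : 'M[R]_(m, n)).
Implicit Types (e : {ffun 'I_n -> nat}) (J : {set 'I_n}).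

(* The vector d of the algorithm is recorded by its exponents; the exponent L
   stands for an entry that has been replaced by 0. *)
Definition scaling e : 'cV[R]_n := \col_j (if (e j < L)%N then 2 ^+ e j else 0).

Definition scaled e : 'M[R]_(m, n) := \matrix_(i, j) (A i j * scaling e j 0).

Definition bump J e : {ffun 'I_n -> nat} :=
  [ffun j => if (j \in J) && (e j < L)%N then (e j).+1 else e j].

Lemma rescaleE J e :
  value (rescale (2 ^+ L) J (scaled e) (scaling e)) =
  (scaled (bump J e), scaling (bump J e)).
Proof.
have pow_ge k : (2 ^+ L <= 2 ^+ k :> R) = ~~ (k < L)%N.
  by rewrite ler_eXn2l ?ltr1n // -leqNgt.
(* An entry already replaced by 0 fails the test against 2^L, but doubling keeps it 0. *)
have p2 : (2 ^+ L <= 0 :> R) = false by rewrite leNgt exprn_gt0.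
have scE j : scaling (bump J e) j 0 =
    if 2 ^+ L <= value (if j \in J then fmul 2 (scaling e j 0) else ret (scaling e j 0))
    then 0 else value (if j \in J then fmul 2 (scaling e j 0) else ret (scaling e j 0)).
  rewrite !mxE ffunE; case: (j \in J) => /=; have [eL|eL] := ltnP (e j) L.
  - by rewrite -exprS pow_ge; case: ltnP.
  - by rewrite ltnNge eL mulr0 p2.
  - by rewrite pow_ge eL.
  - by rewrite p2.
congr (_, _); apply/matrixP => i j; rewrite [LHS]mxE inE /=; last first.
  by rewrite (ord1 j) scE !mxE.
rewrite [RHS]mxE scE !mxE; case: ifP => _; rewrite ?mulr0 //.
by case: ifP => _ //=; rewrite mulrCA.
Qed.

(** Powers of two are nonzero and pairwise distinct, and under the bound [L] a zero entry can only
    stand for the exponent [L]. Hence an unchanged d means unchanged exponents. *)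
Lemma scaling_inj e e' : (forall j, e j <= L)%N -> (forall j, e' j <= L)%N ->
  scaling e = scaling e' -> e = e'.
Proof.
move=> eL e'L /matrixP E; apply/ffunP => j; have := E j 0; rewrite !mxE.
case: ltnP (eL j) => [lt_e _|ge_e le_e]; case: ltnP (e'L j) => [lt_e' _|ge_e' le_e'].
- by apply: ieexprIn; rewrite ?ltr0n ?pnatr_eq1.
- by move/eqP; rewrite expf_eq0 pnatr_eq0 andbF.
- by move/esym/eqP; rewrite expf_eq0 pnatr_eq0 andbF.
- by move=> _; apply/eqP; rewrite eqn_leq (leq_trans le_e) // (leq_trans le_e').
Qed.

Lemma bump_le J e : (forall j, e j <= L)%N -> forall j, (bump J e j <= L)%N.
Proof. by move=> eL j; rewrite ffunE; case: ifP => // /andP[]. Qed.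

Lemma sum_bump J e : bump J e != e -> (\sum_j e j < \sum_j bump J e j)%N.
Proof.
move=> be; have [j bj] : exists j, bump J e j != e j.
  apply/existsP; apply: contraNT be; rewrite negb_exists => /forallP be.
  by apply/eqP/ffunP => j; apply/eqP; have := be j; rewrite negbK.
have ge_e i : (e i <= bump J e i)%N by rewrite ffunE; case: ifP.
rewrite (bigD1 j) //= [X in (_ < X)%N](bigD1 j) //= -addSn leq_add //.
  by rewrite ltn_neqAle eq_sym bj ge_e.
by apply: leq_sum => i _.
Qed.

Lemma cost_rescale J (M : 'M[R]_(m, n)) d :
  (cost (rescale (2 ^+ L) J M d) <= n + m * n + n)%N.
Proof.
rewrite /= addn0 addnA sum_nat_const card_ord muln1 leq_add2r leq_add //.
  by rewrite -[leqRHS]muln1; apply: sum_ord_leq => j; case: ifP.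
apply: sum_ord_leq => i; rewrite -[leqRHS]muln1; apply: sum_ord_leq => j.
by case: ifP.
Qed.

End Exponents.

Lemma cost_row_basis (R : realType) m n (A : 'M[R]_(m, n)) :
  (cost (row_basis A) <= m * (m * (6 * n).+1 + n))%N.
Proof.
rewrite /row_basis.
(* The total length never grows, so one [k] bounds the basis length in every projection. *)
suff gs (ws rs : seq 'cV[R]_n) k : (size ws + size rs <= k)%N ->
    (cost (gram_schmidt ws rs) <= size rs * (k * (6 * n).+1 + n))%N.
  by have := gs [::] [seq (row i A)^T | i <- enum 'I_m] m; rewrite size_map -cardE card_ord; apply.
elim: rs ws => [//|r rs IHrs] ws /= le_k.
set S := [set i | _]; rewrite cost_tproj mulSn.
rewrite sum_nat_const card_ord muln1 addnA leq_add //.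
  by rewrite leq_add2r leq_mul2r (leq_trans _ le_k) ?leq_addr ?orbT.
by apply: IHrs; case: ifP => _ /=; lia.
Qed.

(** * The main loop: cost, stalling, and termination for a feasible dual *)

Section MainLoop.
Variables (R : realType) (c : R) (sel : selection_rule R) (C0 : nat).
Hypotheses (hc : 0 < c < 2) (sel_adm : admissible sel).
Hypothesis C0_ge : 4 / (c * (2 - c)) <= C0%:R.
Variables (m n L : nat) (A : 'M[R]_(m, n)).
Hypotheses (m_gt0 : (0 < m)%N) (m_le_n : (m <= n)%N).
Implicit Types e : {ffun 'I_n -> nat}.

Let n_gt0 : (0 < n)%N := leq_trans m_gt0 m_le_n.
Let step_cost := ((50 * C0 + 100) * (n ^ 3 * m))%N.
Let mat e := scaled L A e.
Let vec e := scaling R L e.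
Let iter A1 d1 A2 d2 k := @main_iter R c sel (2 ^+ L) m n A1 d1 A2 d2 k.
Let iters A1 d1 A2 d2 k := @main_iters R c sel (2 ^+ L) m n A1 d1 A2 d2 k.
Let exit A1 d1 r k := @main_exit R c sel m n A1 d1 r k.

Lemma cost_basic_procedure (M : 'M[R]_(m, n)) r k :
  basic_procedure c sel (value (row_basis M)) r k ->
  (k <= (50 * C0 + 80) * (n ^ 3 * m))%N.
Proof.
have [r' [k' [bp' k'_le]]] := basic_procedure_exists sel hc M n_gt0 m_gt0 C0_ge.
by move=> /basic_procedure_det /(_ bp') [_ ->].
Qed.

(** As m <= n, the costs of Gram-Schmidt, of rescaling and of the output are absorbed by the n^3 m
    of the basic procedure. *)
Lemma lower_order_terms : (m * (m * (6 * n).+1 + n) <= 8 * (n ^ 3 * m))%N /\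
  (m * n <= n ^ 3 * m)%N /\ (n <= n ^ 3 * m)%N.
Proof.
have n1 : (n <= n ^ 3)%N by rewrite -{1}(expn1 n) leq_pexp2l.
have n2 : (n ^ 2 <= n ^ 3)%N by rewrite leq_pexp2l.
split; last first.
  split; first by rewrite mulnC leq_mul2r n1 orbT.
  by rewrite (leq_trans n1) // leq_pmulr.
rewrite mulnC mulnA leq_mul2r; apply/orP; right.
by apply: leq_trans (_ : 8 * n ^ 2 <= _)%N; [nia | rewrite leq_mul2l].
Qed.

Lemma main_iter_det M d M1 d1 k1 M2 d2 k2 :
  iter M d M1 d1 k1 -> iter M d M2 d2 k2 -> M1 = M2 /\ d1 = d2.
Proof.
move=> [y [z [J [k [bp1 U1 _]]]]] [y' [z' [J' [k' [bp2 U2 _]]]]].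
have [[_ _ eJ] _] := basic_procedure_det bp1 bp2.
by move: U2; rewrite -eJ U1 => -[].
Qed.

Lemma main_iter_not_exit M d M' d' k r k' : iter M d M' d' k -> ~ exit M d r k'.
Proof.
move=> [y [z [J [k1 [bp1 _ _]]]]] ex.
by case: ex bp1 => [y' z' k2 B bp2|y' z' k2 B X bp2] /basic_procedure_det /(_ bp2) [].
Qed.

Lemma main_iter_scaled e M d k : iter (mat e) (vec e) M d k ->
  exists y z J, [/\ z = Pproj (mat e) *m y, J != set0,
    J \subset value (tcandidates z), (M, d) = (mat (bump L J e), vec (bump L J e)) &
    (k <= step_cost)%N].
Proof.
move=> [y [z [J [k' [bp U ->]]]]]; exists y, z, J.
have [zE J0 Jc] := basic_procedure_case0 hc sel_adm n_gt0 bp.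
have bp_le := cost_basic_procedure bp.
split=> //; first by rewrite -U rescaleE.
have := cost_row_basis (mat e); have := cost_rescale L J (mat e) (vec e).
have [] := lower_order_terms; rewrite /step_cost; lia.
Qed.

Lemma main_exit_cost M d r k : exit M d r k -> (k <= step_cost)%N.
Proof.
have [lot1 [lot2 lot3]] := lower_order_terms.
have rb_le := cost_row_basis M.
case=> [y z k' B bp|y z k' B X bp]; have bp_le := cost_basic_procedure bp.
  by rewrite /step_cost /B; lia.
by rewrite /step_cost /B /X /= sum_nat_const card_ord; lia.
Qed.

Lemma main_stalled_iters M d k M' d' k' : iter M d M d k ->
  iters M d M' d' k' -> M' = M /\ d' = d.
Proof.
move=> stall its; elim: its stall => {M d M' d' k'} // M d M1 d1 M2 d2 k1 k2 it1 _ IH stall.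
by have [eM ed] := main_iter_det stall it1; rewrite -eM -ed in IH; exact: IH.
Qed.

(* The algorithm is deterministic, so a run that halts has never reached a
   state fixed by the iteration; hence each of its iterations increases the
   sum of the exponents. *)
Lemma main_iters_cost e M d k r k' : (forall j, e j <= L)%N ->
  iters (mat e) (vec e) M d k -> exit M d r k' ->
  (k + step_cost * (\sum_j e j) <= step_cost * (n * L))%N.
Proof.
move EM: (mat e) => M1; move Ed: (vec e) => d1.
move=> + its ex; elim: its ex e EM Ed => {M M1 d d1 k} [M d|M d M1 d1 M2 d2 k1 k2 it1 its IH] ex e EM Ed eL.
  by rewrite leq_mul2l; apply/orP; right; exact: sum_ord_leq.
subst M d; have [y [z [J [_ _ _ [M1E d1E] k1_le]]]] := main_iter_scaled it1.
subst M1 d1; have [bE|be] := eqVneq (bump L J e) e.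
  rewrite bE in it1 its; have [M2E d2E] := main_stalled_iters it1 its.
  by rewrite M2E d2E in ex; case: (main_iter_not_exit it1 ex).
have := IH ex _ erefl erefl (bump_le J eL).
have lt_e := sum_bump be.
have : (step_cost * (\sum_j e j).+1 <= step_cost * \sum_j (bump L J e) j)%N.
  by rewrite leq_mul2l lt_e orbT.
by rewrite mulnS; lia.
Qed.

(** Every call of the basic procedure halts, so an iteration exits, or fixes the exponents and thus
    stalls, or raises their sum. Induction is on the gap between that sum and nL. *)
Lemma main_iters_exists e : (forall j, e j <= L)%N ->
  exists e2 k, [/\ iters (mat e) (vec e) (mat e2) (vec e2) k,
    (k + step_cost * (\sum_j e j) <= step_cost * (n * L))%N &
    (exists r k', exit (mat e2) (vec e2) r k') \/
    (exists k', iter (mat e2) (vec e2) (mat e2) (vec e2) k')].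
Proof.
have [t] := ubnP (n * L - \sum_j e j); elim: t e => // t IH e lt_t eL.
have sum_le : (\sum_j e j <= n * L)%N by exact: sum_ord_leq.
have base : (0 + step_cost * (\sum_j e j) <= step_cost * (n * L))%N.
  by rewrite leq_mul2l sum_le orbT.
have [r [k [bp _]]] := basic_procedure_exists sel hc (mat e) n_gt0 m_gt0 C0_ge.
case: r bp => [y z|y z|y z J] bp.
- exists e, 0%N; split=> //; first exact: ItersNil.
  by left; do 2!eexists; exact: ExitCase2 bp.
- exists e, 0%N; split=> //; first exact: ItersNil.
  by left; do 2!eexists; exact: ExitCase1 bp.
have [k1 it1] : exists k1, iter (mat e) (vec e) (mat (bump L J e)) (vec (bump L J e)) k1.
  by eexists; exists y, z, J, k; split; [exact: bp | rewrite rescaleE |].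
have [bE|be] := eqVneq (bump L J e) e.
  exists e, 0%N; split=> //; first exact: ItersNil.
  by right; exists k1; rewrite bE in it1.
have lt_e := sum_bump be.
have [|e2 [k2 [its k2_le end2]]] := IH (bump L J e) _ (bump_le J eL).
  by apply: leq_trans (ltn_sub2l _ lt_e) _; rewrite ?(leq_trans lt_e) //;
    exact: (sum_ord_leq (bump_le J eL)).
exists e2, (k1 + k2)%N; split=> //; first exact: ItersCons it1 its.
have [_ [_ [_ [_ _ _ _ k1_le]]]] := main_iter_scaled it1.
have : (step_cost * (\sum_j e j).+1 <= step_cost * \sum_j (bump L J e) j)%N.
  by rewrite leq_mul2l lt_e orbT.
by rewrite mulnS; lia.
Qed.

(* The loop invariant that keeps the entries of d below 2^L when the dual is
   feasible. *)
Definition capped e := forall x : 'cV[R]_n, in_rows A x ->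
  (forall j, 0 <= x j 0 <= 1) -> forall j, 2 ^+ e j * x j 0 <= 1.

(** This is where dual feasibility enters; [bit_size_large_coordinates] provides it. *)
Hypothesis large_coordinates : forall j, exists x : 'cV[R]_n,
  [/\ in_rows A x, forall i, 0 <= x i 0 <= 1 & 1 < 2 ^+ L * x j 0].

Lemma capped_lt e : capped e -> forall j, (e j < L)%N.
Proof.
move=> cap j; have [x [Ax x01 xj]] := large_coordinates j.
rewrite ltnNge; apply: contraTN xj => eL; rewrite -leNgt.
apply: le_trans (cap x Ax x01 j).
by rewrite ler_wpM2r ?ler_eXn2l ?ltr1n //; have /andP[] := x01 j.
Qed.

(** The scaled vector with entries 2^(e_i) x_i lies in the row space of the scaled matrix and in the
    unit box, so its entries in J are at most 1/2 and may be doubled. *)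
Lemma capped_bump e y z (J : {set 'I_n}) : capped e ->
  z = Pproj (mat e) *m y -> J \subset value (tcandidates z) -> capped (bump L J e).
Proof.
move=> cap zE Jc x Ax x01 j; rewrite ffunE; case: ifP => [/andP[jJ _]|_]; last exact: cap.
have [t xE] := Ax.
(* By [capped_lt] no column has been zeroed, so [scaling] is the honest power of two. *)
have matx : in_rows (mat e) (\col_i (2 ^+ e i * x i 0)).
  exists t; apply/colP => i; rewrite mxE xE !mxE mulr_sumr; apply: eq_bigr => l _.
  by rewrite !mxE (capped_lt cap) mulrA [2 ^+ _ * _]mulrC.
have := candidates_le_half _ matx _ (subsetP Jc j jJ); rewrite mxE exprS.
rewrite zE mulmxA mulmx_Pproj mul0mx => /(_ erefl) xj.
have : 2 ^+ e j * x j 0 <= 1 / 2.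
  apply: xj => i; rewrite mxE cap // andbT mulr_ge0 ?exprn_ge0 //.
  by have /andP[] := x01 i.
by lra.
Qed.

(** J is nonempty and all exponents stay below [L], so every iteration raises some exponent. *)
Lemma capped_not_stalled e M d k k' : capped e ->
  iters (mat e) (vec e) M d k -> ~ iter M d M d k'.
Proof.
move EM: (mat e) => M1; move Ed: (vec e) => d1.
move=> + its; elim: its e EM Ed => {M M1 d d1 k} [M d|M d M1 d1 M2 d2 k1 k2 it1 its IH] e EM Ed cap.
  subst M d => /main_iter_scaled [y [z [J [zE J0 Jc [_ d_eq] _]]]].
  have [j jJ] := set0Pn _ J0.
  have eL i : (e i <= L)%N by rewrite ltnW // capped_lt.
  have /ffunP/(_ j) := scaling_inj eL (bump_le J eL) d_eq.
  by rewrite ffunE jJ capped_lt //=; lia.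
subst M d; have [y [z [J [zE _ Jc [M1E d1E] _]]]] := main_iter_scaled it1.
by apply: (IH (bump L J e)) => //; exact: (capped_bump cap zE Jc).
Qed.

End MainLoop.

(** * Existence of a vertex of the polyhedron M u >= 1 *)

Section Vertex.
Variables (R : realType) (n m : nat) (M : 'M[R]_(n, m)).
Hypothesis M_full : row_full M.
Implicit Type u : 'cV[R]_m.

Let tight u := [set j | (M *m u) j 0 == 1].

(* Move u along a direction orthogonal to all tight rows until a new
   constraint becomes tight. *)
Lemma tight_rows_extend u : (forall j, 1 <= (M *m u) j 0) ->
    ~~ row_full (\matrix_(j, k) (M j k *+ (j \in tight u))) ->
  exists2 u', forall j, 1 <= (M *m u') j 0 & tight u \proper tight u'.
Proof.
set MT := \matrix_(j, k) _ => u_ge1; rewrite -cokermx_eq0.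
move=> cok0; have [w w0 MTw] : exists2 w : 'cV_m, w != 0 & MT *m w = 0.
  have [k ck0] : exists k, col k (cokermx MT) != 0.
    apply/existsP; apply: contraNT cok0; rewrite negb_exists => /forallP cok0.
    apply/eqP/matrixP => i k; have := cok0 k; rewrite negbK => /eqP/colP/(_ i).
    by rewrite !mxE.
  by exists (col k (cokermx MT)) => //; rewrite colE mulmxA mulmx_coker mul0mx.
(* Full column rank makes M w nonzero; replace w by its opposite if the entry found is positive. *)
wlog [j0 gj0] : w w0 MTw / exists j, (M *m w) j 0 < 0.
  move=> IH; have : M *m w != 0.
    by apply: contraNneq w0 => Mw0; apply/eqP; apply: (row_full_inj M_full); rewrite Mw0 mulmx0.
  have [j gj|] := pickP (fun j => (M *m w) j 0 != 0); last first.
    by move=> g0 /eqP[]; apply/colP => j; apply/eqP; rewrite [X in _ == X]mxE; have /negbFE := g0 j.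
  move=> _; case: (ltrgtP ((M *m w) j 0) 0) gj => // gj _; first by apply: IH w0 MTw _; exists j.
  apply: (IH (- w)); rewrite ?oppr_eq0 ?mulmxN ?MTw ?oppr0 //.
  by exists j; rewrite mxE oppr_lt0.
have gT j : j \in tight u -> (M *m w) j 0 = 0.
  move=> jT; have /colP/(_ j) := MTw; rewrite !mxE => MTwj.
  by rewrite -[RHS]MTwj; apply: eq_bigr => k _; rewrite mxE jT.
(* Ratio test: the smallest step at which a decreasing constraint reaches 1. *)
pose step j := ((M *m u) j 0 - 1) / - (M *m w) j 0.
have [j gj step_min] := @arg_minP _ _ _ j0 (fun j => (M *m w) j 0 < 0) step gj0.
exists (u + step j *: w).
  move=> k; rewrite mulmxDr -scalemxAr [X in _ <= X]mxE [X in _ + X]mxE.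
  have step_ge0 : 0 <= step j by rewrite divr_ge0 ?oppr_ge0 ?subr_ge0 ?(ltW gj).
  have [gk|gk] := leP 0 ((M *m w) k 0).
    by rewrite (le_trans (u_ge1 k)) // lerDl mulr_ge0.
  have := step_min k gk; rewrite [step k]/step ler_pdivlMr ?oppr_gt0 //; lra.
have tightE k : (k \in tight (u + step j *: w)) =
    ((M *m u) k 0 + step j * (M *m w) k 0 == 1).
  by rewrite inE mulmxDr -scalemxAr [X in X == _]mxE [X in _ + X]mxE.
apply/properP; split.
  apply/subsetP => k kT; rewrite tightE gT // mulr0 addr0.
  by move: kT; rewrite inE.
exists j; last by apply: contraTN gj => /gT ->; rewrite ltxx.
have stepE : step j * (M *m w) j 0 = 1 - (M *m u) j 0.
  by rewrite /step invrN mulrN mulNr divfK ?opprB // lt_eqF.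
by rewrite tightE stepE addrC subrK.
Qed.

(** Scale [u] into the polyhedron, then enlarge the tight set, which has at most n elements, until
    the tight rows have full rank; [f] picks a basis among them. *)
Lemma vertex_exists u : (forall j, 0 < (M *m u) j 0) ->
  exists u' (f : 'I_m -> 'I_n), [/\ forall j, 1 <= (M *m u') j 0,
    injective f, forall i, (M *m u') (f i) 0 = 1 & rowsub f M \in unitmx].
Proof.
move=> Mu; pose s := \sum_j ((M *m u) j 0)^-1.
have : exists u1, forall j, 1 <= (M *m u1) j 0.
  exists (s *: u) => j; rewrite -scalemxAr mxE -ler_pdivrMr // mul1r /s (bigD1 j) //=.
  by rewrite lerDl sumr_ge0 // => k _; rewrite invr_ge0 ltW.
case=> {Mu s} {}u u_ge1; have [t] := ubnP (n - #|tight u|).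
elim: t u u_ge1 => // t IH u u_ge1 lt_t.
have [full|] := boolP (row_full (\matrix_(j, k) (M j k *+ (j \in tight u)))); last first.
  case/(tight_rows_extend u_ge1) => u' u'_ge1 /proper_card lt_u.
  apply: IH u'_ge1 _; apply: leq_trans (ltn_sub2l _ lt_u) _ => //.
  by rewrite (leq_trans lt_u) // -[X in (_ <= X)%N]card_ord max_card.
have := fullrowsub_unit full; set f := fullrankfun full => uf.
(* Rows that are not tight were set to zero, and an invertible submatrix has no zero row. *)
have fT i : f i \in tight u.
  apply: contraT => /negPf fiT; set N := rowsub _ _ in uf.
  have /rowP/(_ i) : delta_mx 0 i = 0 :> 'rV[R]_m.
    rewrite -[LHS](mulmxK uf) -rowE (_ : row i N = 0) ?mul0mx //.
    by apply/rowP => k; rewrite !mxE fiT.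
  by move/eqP; rewrite !mxE !eqxx oner_eq0.
exists u, f; split=> //; first exact: fullrankfun_inj.
  by move=> i; have := fT i; rewrite inE => /eqP.
by congr (_ \in unitmx): uf; apply/matrixP => i k; rewrite !mxE fT.
Qed.
End Vertex.

(** * Bounds on vertex coordinates from the bit size *)

Section BitBounds.
Variable R : realType.

Lemma rat_bits_bound (q : rat) :
  (denq q)%:~R * (1 + `|ratr q|) <= 2 ^+ (rat_bits q).-1 :> R.
Proof.
have d_gt0 : 0 < (denq q)%:~R :> R by rewrite ltr0z denq_gt0.
have -> : (denq q)%:~R * (1 + `|ratr q|) = (absz (denq q) + absz (numq q))%:R :> R.
  rewrite /ratr normrM normfV (gtr0_norm d_gt0) mulrDr mulr1 mulrCA divff ?gt_eqF //.
  by rewrite mulr1 natrD !natr_absz !intr_norm (gtr0_norm d_gt0).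
rewrite -natrX ler_nat.
have num_le := @up_logP 2 (absz (numq q)).+1 isT.
rewrite /rat_bits Qint_def /int_bits; case: eqP => [->|_] //=; rewrite expnD.
have den_le := @up_logP 2 (absz (denq q)).+1 isT.
by apply: leq_trans (leq_mul num_le den_le); lia.
Qed.

Lemma rat_bits_gt0 (q : rat) : (0 < rat_bits q)%N.
Proof. by rewrite /rat_bits /int_bits; case: ifP. Qed.

(** Expanding the product gives one nonnegative term per self-map of the indices; the Leibniz
    formula uses only those of permutations. *)
Lemma det_le_prod_norms n (N : 'M[R]_n) :
  `|\det N| <= \prod_i \sum_j `|N i j|.
Proof.
rewrite bigA_distr_bigA /= (le_trans (ler_norm_sum _ _ _)) //.
pose F (f : {ffun 'I_n -> 'I_n}) := \prod_i `|N i (f i)|.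
rewrite (eq_bigr (fun s : 'S_n => F (pval s))) => [|s _]; last first.
  rewrite normrM normrX normrN1 expr1n mul1r normr_prod.
  by apply: eq_bigr => i _; rewrite pvalE.
rewrite -(big_imset F (h := @pval _)) /=; last by move=> s t _ _; exact: val_inj.
rewrite [leRHS](bigID [in [set pval s | s in 'S_n]]) /= lerDl sumr_ge0 // => f _.
by apply: prodr_ge0 => i _.
Qed.

Lemma add1_sum_le_prod (I : finType) (F : I -> R) : (forall i, 0 <= F i) ->
  1 + \sum_i F i <= \prod_i (1 + F i).
Proof.
move=> F0; suff [] : 1 + \sum_i F i <= \prod_i (1 + F i) /\ 0 <= \sum_i F i by [].
elim/big_rec2: _ => [|i p s _ [IH s0]]; first by rewrite addr0.
have := F0 i; split; nra.
Qed.

Lemma ratr_mul_denq (q : rat) : ratr q * (denq q)%:~R = (numq q)%:~R :> R.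
Proof. by rewrite divfK // intr_eq0 denq_neq0. Qed.

Variables (m n : nat) (A : 'M[rat]_(m, n)) (f : 'I_m -> 'I_n) (u : 'cV[R]_m).
Let M : 'M[R]_(n, m) := (map_mx ratr A)^T.
Hypotheses (f_inj : injective f) (fu : forall i, (M *m u) (f i) 0 = 1).
Hypothesis fM_unit : rowsub f M \in unitmx.

(** [den j] clears the denominators of row [j] of [M]; [height j] dominates one plus the sum of the
    absolute values of that row. *)
Let den j : R := \prod_i (denq (A i j))%:~R.
Let height j : R := \prod_i (1 + `|M j i|).

Let den_ge1 j : 1 <= den j.
Proof.
rewrite /den; elim/big_rec: _ => // i p _ p_ge1.
by rewrite mulr_ege1 // ler1z -gtz0_ge1 denq_gt0.
Qed.

(* Scaling row i by den (f i) makes the matrix integral. *)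
Lemma det_basis_ge : 1 <= `|\det (rowsub f M)| * \prod_i den (f i).
Proof.
pose D : 'rV[R]_m := \row_i den (f i).
have detE : \det (diag_mx D *m rowsub f M) = \prod_i den (f i) * \det (rowsub f M).
  by rewrite det_mulmx det_diag; congr (_ * _); apply: eq_bigr => i _; rewrite mxE.
have den0 : 0 < \prod_i den (f i) by rewrite prodr_gt0 // => i _; exact: lt_le_trans (den_ge1 _).
rewrite -[X in _ * X](gtr0_norm den0) -normrM mulrC -detE norm_intr_ge1 //; last first.
  by rewrite detE mulf_neq0 ?(gt_eqF den0) // -unitfE -unitmxE.
rewrite rpred_sum // => s _; rewrite rpredM ?rpredX ?rpredN ?rpred1 //.
rewrite rpred_prod // => i _; rewrite mul_diag_mx !mxE /den (bigD1 (s i)) //=.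
rewrite mulrC mulrA ratr_mul_denq rpredM ?intr_int // rpred_prod // => k _.
exact: intr_int.
Qed.

(* With B = rowsub f M and a = row j M, eliminating the last column of
   [[B, 1], [a, 0]] leaves the Schur complement - a u, because B u = 1. *)
Lemma basic_solution_le j : `|\det (rowsub f M)| * `|(M *m u) j 0| <=
  \prod_i height (f i) * height j.
Proof.
pose N : 'M[R]_(m + 1) := block_mx (rowsub f M) (const_mx 1) (row j M) 0.
have fuE : rowsub f M *m u = const_mx 1.
  apply/colP => i; rewrite [RHS]mxE -(fu i) !mxE.
  by apply: eq_bigr => k _; rewrite !mxE.
have NE : N *m block_mx 1%:M (- u) 0 1%:M =
    block_mx (rowsub f M) 0 (row j M) (- row j (M *m u)).
  rewrite mulmx_block !mulmx1 !mulmx0 ?mul0mx !addr0 !mulmxN row_mul; congr block_mx.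
  by rewrite fuE addNr.
have /esym := congr1 determinant NE.
rewrite det_mulmx det_ublock !det1 !mulr1 det_lblock det_mx11 !mxE mulrN => detN.
have -> : `|\det (rowsub f M)| * `|\sum_k M j k * u k 0| = `|\det N|.
  by rewrite -detN normrN normrM.
(* The bordering entry 1 of each upper row supplies the 1 in front of the row sum. *)
apply: le_trans (det_le_prod_norms N) _.
rewrite big_split_ord /= big_ord1.
rewrite ler_pM ?prodr_ge0 ?sumr_ge0 // => [i _||].
- by rewrite sumr_ge0.
- apply: ler_prod => i _; rewrite sumr_ge0 //= big_split_ord big_ord1 /=.
  rewrite block_mxEur !mxE normr1 addrC (le_trans _ (add1_sum_le_prod _)) //.
  by rewrite lerD2l; apply: ler_sum => k _; rewrite block_mxEul !mxE.
rewrite big_split_ord big_ord1 /= block_mxEdr mxE normr0 addr0.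
apply: le_trans (_ : 1 + \sum_k `|M j k| <= _); last exact: add1_sum_le_prod.
by rewrite -[leLHS]add0r lerD //; apply: ler_sum => k _; rewrite block_mxEdl !mxE.
Qed.

(** Combine [basic_solution_le] with the lower bound on the determinant: each basic column
    contributes height times den, column [j] its height. These columns are distinct when [j] is not
    basic, so each entry of [A] is charged at most once. *)
Lemma vertex_coordinate_le j :
  (M *m u) j 0 <= 2 ^+ (\sum_i \sum_k (rat_bits (A i k)).-1).
Proof.
pose b k : R := \prod_i 2 ^+ (rat_bits (A i k)).-1.
have b_ge1 k : 1 <= b k.
  by rewrite /b; elim/big_rec: _ => // i p _ p_ge1; rewrite mulr_ege1 // exprn_ege1 // ler1n.
have prodb_ge1 (P : pred 'I_n) : 1 <= \prod_(k | P k) b k.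
  by elim/big_rec: _ => // i p _ p_ge1; rewrite mulr_ege1.
have -> : 2 ^+ (\sum_i \sum_k (rat_bits (A i k)).-1) = \prod_k b k.
  rewrite exchange_big /= expr_sum; apply: eq_bigr => k _; exact: expr_sum.
have [|jf] := boolP (j \in codom f).
  by case/codomP => i ->; rewrite fu.
have height_ge0 k : 0 <= height k by rewrite prodr_ge0 // => i _; rewrite addr_ge0.
have den_ge0 k : 0 <= den k by exact: le_trans (den_ge1 k).
have den_height k : den k * height k <= b k.
  rewrite -big_split /=; apply: ler_prod => i _; rewrite !mxE rat_bits_bound andbT.
  by rewrite mulr_ge0 ?addr_ge0 // ler0z ltW // denq_gt0.
have height_le k : height k <= b k.
  by apply: le_trans (den_height k); rewrite ler_peMl.
apply: le_trans (ler_norm _) _.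
apply: le_trans (ler_peMl (normr_ge0 _) det_basis_ge) _.
rewrite mulrAC; apply: le_trans (ler_wpM2r _ (basic_solution_le j)) _.
  by rewrite prodr_ge0.
rewrite mulrAC -big_split /=.
apply: (@le_trans _ _ (\prod_i b (f i) * b j)).
  have prod_ge0 : 0 <= \prod_i (height (f i) * den (f i)).
    by rewrite prodr_ge0 // => i _; rewrite mulr_ge0.
  rewrite ler_pM //; apply: ler_prod => i _; rewrite mulr_ge0 //= mulrC.
  exact: den_height.
have -> : \prod_i b (f i) = \prod_(k in codom f) b k.
  transitivity (\prod_(i in [set: 'I_m]) b (f i)).
    by apply: eq_bigl => i; rewrite inE.
  rewrite -(big_imset b) /=; last by move=> ? ? _ _ /f_inj.
  apply: eq_bigl => k; apply/idP/idP => [/imsetP[i _ ->]|/codomP[i ->]].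
    exact: codom_f.
  by rewrite imset_f ?inE.
rewrite [leRHS](bigID [in codom f]) /= ler_wpM2l //.
  exact: le_trans (prodb_ge1 _).
rewrite (bigD1 j) //= ler_peMr //.
exact: le_trans (b_ge1 j).
Qed.

End BitBounds.

(** Divide the slacks A^T v of a vertex v, which lie between 1 and 2^L, by 2^L. Each entry of [A]
    lost one bit in this L, so L is below the bit size and the last inequality is strict. *)
Lemma bit_size_large_coordinates (R : realType) m n (A : 'M[rat]_(m, n)) :
    (0 < m)%N -> \rank A = m ->
    (exists u : 'cV[R]_m, forall j : 'I_n, 0 < ((map_mx ratr A)^T *m u) j 0) ->
  forall j : 'I_n, exists x : 'cV[R]_n,
    [/\ in_rows (map_mx ratr A) x, forall i, 0 <= x i 0 <= 1 &
        1 < 2 ^+ bit_size A * x j 0].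
Proof.
move=> m_gt0 rA [u u_gt0] j.
have full : row_full (map_mx ratr A : 'M[R]_(m, n))^T.
  by rewrite /row_full mxrank_tr mxrank_map rA.
have [v [f [v_ge1 f_inj fv f_unit]]] := vertex_exists full u_gt0.
set L := \sum_i \sum_k (rat_bits (A i k)).-1.
have v_le k : ((map_mx ratr A)^T *m v) k 0 <= 2 ^+ L.
  exact: vertex_coordinate_le f_inj fv f_unit k.
have L_lt : (L < bit_size A)%N.
  rewrite /bit_size /L; have i : 'I_m := Ordinal m_gt0.
  rewrite (bigD1 i) //= [X in (_ < X)%N](bigD1 i) //= -addSn leq_add //.
    rewrite (bigD1 j) //= [X in (_ < X)%N](bigD1 j) //= -addSn prednK ?rat_bits_gt0 //.
    by rewrite leq_add2l leq_sum // => k _; exact: leq_pred.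
  by apply: leq_sum => k _; apply: leq_sum => l _; exact: leq_pred.
have p_gt0 : 0 < 2 ^+ L :> R by rewrite exprn_gt0.
exists ((2 ^+ L)^-1 *: ((map_mx ratr A)^T *m v)); split.
- by exists ((2 ^+ L)^-1 *: v); rewrite scalemxAr.
- move=> i; rewrite mxE mulrC divr_ge0 ?(ltW p_gt0) ?(le_trans ler01 (v_ge1 i)) //=.
  by rewrite ler_pdivrMr // mul1r.
rewrite mxE mulrA; apply: lt_le_trans (_ : 2 ^+ bit_size A / 2 ^+ L <= _).
  by rewrite ltr_pdivlMr // mul1r ltr_eXn2l ?ltr1n.
by rewrite ler_peMr // divr_ge0 ?exprn_ge0.
Qed.

(** * Total running time *)

Lemma scale_limitE (R : realType) m n (A : 'M[rat]_(m, n)) :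
  scale_limit R A = Timed (2 ^+ bit_size A) (bit_size A).
Proof.
rewrite /scale_limit /fpow; elim: (bit_size A) => // k IH.
by rewrite iterS IH /bind /= exprS addn1.
Qed.

Theorem theorem2 (R : realType) (c : R) (hc : 0 < c < 2) :
  exists C : nat,
  forall (sel : selection_rule R), admissible sel ->
  forall (m n : nat) (A : 'M[rat]_(m, n)), (0 < m)%N -> \rank A = m ->
    [/\ (forall (r : outcome R n) (k : nat), dual_algorithm c sel A r k ->
           (k <= C * (n ^ 4 * m * bit_size A))%N),
        ((exists u : 'cV[R]_m,
            forall j : 'I_n, 0 < ((map_mx ratr A)^T *m u) j 0) ->
         exists (r : outcome R n) (k : nat), dual_algorithm c sel A r k)
      & ((exists (r : outcome R n) (k : nat), dual_algorithm c sel A r k) \/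
         (exists2 k : nat, dual_algorithm_stalls c sel A k &
           (k <= C * (n ^ 4 * m * bit_size A))%N))].
Proof.
set C0 := Num.bound (4 / (c * (2 - c))).
have C0_ge : 4 / (c * (2 - c)) <= C0%:R.
  have [c_gt0 c_lt2] := andP hc.
  by rewrite ltW // archi_boundP // divr_ge0 // mulr_ge0 ?subr_ge0 ?ltW.
(* One [S] pays for the at most nL state-changing iterations, one for the last iteration, and the 1
   for computing 2^L. *)
pose S := (50 * C0 + 100)%N; exists (2 * S).+1 => sel sel_adm m n A m_gt0 rA.
have m_le_n : (m <= n)%N by rewrite -rA rank_leq_col.
have n_gt0 : (0 < n)%N by exact: leq_trans m_le_n.
set L := bit_size A; pose AR : 'M[R]_(m, n) := map_mx ratr A.
have L_gt0 : (0 < L)%N.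
  rewrite /L /bit_size (bigD1 (Ordinal m_gt0)) //= (bigD1 (Ordinal n_gt0)) //=.
  by rewrite -addnA addn_gt0 rat_bits_gt0.
pose e0 : {ffun 'I_n -> nat} := [ffun=> 0%N].
have vec0 : const_mx 1 = scaling R L e0.
  by apply/colP => j; rewrite !mxE ffunE L_gt0.
have mat0 : AR = scaled L AR e0.
  by apply/matrixP => i j; rewrite [RHS]mxE -vec0 [const_mx _ _ _]mxE mulr1.
have e0_le j : (e0 j <= L)%N by rewrite ffunE.
have cost_le k1 k2 : (k1 <= S * (n ^ 3 * m) * (n * L))%N ->
    (k2 <= S * (n ^ 3 * m))%N ->
    (L + k1 + k2 <= (2 * S).+1 * (n ^ 4 * m * L))%N.
  move=> k1_le k2_le; have q_gt0 : (0 < n * L)%N by rewrite muln_gt0 n_gt0.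
  have k2_le' : (k2 <= S * (n ^ 3 * m) * (n * L))%N.
    by rewrite (leq_trans k2_le) // leq_pmulr.
  have L_le : (L <= n ^ 4 * m * L)%N by rewrite leq_pmull // muln_gt0 expn_gt0 n_gt0.
  have qE : (S * (n ^ 3 * m) * (n * L) = S * (n ^ 4 * m * L))%N by rewrite (expnSr n 3); ring.
  by rewrite qE in k1_le k2_le'; rewrite mulSn -mulnA; lia.
have its_exist := main_iters_exists hc sel_adm C0_ge AR m_gt0 m_le_n e0_le.
rewrite -mat0 -vec0 in its_exist.
have [e [k1 [its k1_le fin]]] := its_exist.
have halt r' k' : main_exit c sel (scaled L AR e) (scaling R L e) r' k' ->
    exists r k, dual_algorithm c sel A r k.
  move=> ex; exists r'; eexists; exists (scaled L AR e), (scaling R L e), k1, k'.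
  by split; [rewrite scale_limitE | exact: ex | reflexivity].
split.
- move=> r k [A' [d' [k2 [k3 [its' ex ->]]]]]; rewrite scale_limitE /= in its' *.
  apply: cost_le; last exact: (main_exit_cost hc C0_ge m_gt0 m_le_n ex).
  rewrite -/AR vec0 {1}mat0 in its'.
  have := main_iters_cost hc sel_adm C0_ge m_gt0 m_le_n e0_le its' ex.
  by apply: leq_trans; exact: leq_addr.
- case=> u u_gt0; case: fin => [[r' [k' ex]]|[k' stall]]; first exact: halt ex.
  have large := bit_size_large_coordinates m_gt0 rA (ex_intro _ u u_gt0).
  have cap : capped AR e0.
    by move=> x _ x01 j; rewrite ffunE mul1r; have /andP[] := x01 j.
  rewrite vec0 {1}mat0 in its.
  by case: (capped_not_stalled hc sel_adm C0_ge m_gt0 m_le_n large cap its stall).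
- case: fin => [[r' [k' ex]]|[k' stall]]; [left; exact: halt ex | right].
  exists (L + k1)%N.
    exists (scaled L AR e), (scaling R L e), k1, k'.
    by split; rewrite ?scale_limitE.
  (* A stalled run has no exit iteration, so that cost is 0. *)
  rewrite -(addn0 (L + k1)%N); apply: cost_le => //.
  by apply: leq_trans k1_le; exact: leq_addr.
Qed.
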